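(* Let $G=(V,E)$ be a fullerene graph having a nontrivial cyclic $5$-edge cut. Then the number of perfect matchings of $G$ is at most $20^{\frac{|V|}{12}}$.
   Context: A fullerene graph is a planar cubic ($3$-regular) simple graph, embedded in the plane so that every face, including the unbounded one, is a pentagon or a hexagon (bounded by a cycle of length $5$ or $6$). A cyclic $5$-edge cut of $G$ is a set of $5$ edges whose removal separates $G$ into two components each of which contains a cycle; it is trivial if one of the two components is a single $5$-cycle, and nontrivial otherwise. *)

(* Defs.v *)
From mathcomp Require Import all_boot perm.

Set Implicit Arguments.
Unset Strict Implicit.
Unset Printing Implicit Defensive.

Record sgraph := SGraph {
  vertex :> finType;
  adj : rel vertex;
  adj_sym : symmetric adj;
  adj_irrefl : irreflexive adj
}.

Section Components.
Variables (T : finType) (r : rel T).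

Definition components : {set {set T}} :=
  equivalence_partition (connect r) [set: T].

Definition contains_cycle (A : {set T}) : Prop :=
  exists c : seq T, [/\ ucycle r c, 2 < size c & {subset c <= A}].

(* The subgraph of [r] induced on [A] is a 5-cycle: the last clause excludes
   chords. *)
Definition is_5_cycle (A : {set T}) : Prop :=
  exists c : seq T,
    [/\ ucycle r c, size c = 5, c =i A
      & {in A &, forall x y, r x y -> (y == next c x) || (x == next c y)}].

End Components.

Section Graph.
Variable G : sgraph.

Definition edges : {set {set G}} :=
  [set [set p.1; p.2] | p : G * G & adj p.1 p.2].

Definition connected : Prop := #|components (@adj G)| = 1.

Definition cubic : Prop := forall v : G, #|[set w | adj v w]| = 3.

Definition perfect_matchings : {set {set {set G}}} :=
  [set M : {set {set G}} | (M \subset edges)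
     && [forall v : G, #|[set a in M | v \in a]| == 1]].

(* Embeddings are combinatorial maps on the darts (oriented edges) of G. *)
Definition dart : finType := {p : G * G | adj p.1 p.2}.

Definition dart_src (d : dart) : G := (val d).1.

Lemma dart_rev_proof (d : dart) : adj (val d).2 (val d).1.
Proof. by rewrite adj_sym; exact: (valP d). Qed.

Definition dart_rev (d : dart) : dart :=
  exist (fun p : G * G => adj p.1 p.2) ((val d).2, (val d).1)
    (dart_rev_proof d).

(* [s] cyclically permutes the darts leaving each vertex. *)
Definition rotation_system (s : {perm dart}) : Prop :=
  forall d : dart, porbit s d = [set d' | dart_src d' == dart_src d].

(* Faces are the orbits of [face_step s], each being the closed walk that
   traverses the boundary of that face on a fixed side. *)
Definition face_step (s : {perm dart}) (d : dart) : dart := s (dart_rev d).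

Definition face_walk (s : {perm dart}) (d : dart) : seq G :=
  map dart_src (orbit (face_step s) d).

(* For connected G, Euler's formula says that the closed surface carrying the
   rotation system is a sphere, i.e. that the embedding is a plane one; the
   unbounded face is then one of the orbits. *)
Definition plane_embedding (s : {perm dart}) : Prop :=
  rotation_system s /\
  #|G| + fcard (face_step s) predT = #|edges| + 2.

(* A face with duplicate-free boundary walk is bounded by a cycle.
   Connectedness is explicit because face orbits of a disconnected graph do not
   see that a face with several boundary components is not bounded by a cycle. *)
Definition fullerene : Prop :=
  [/\ connected, cubic
    & exists2 s : {perm dart}, plane_embedding s
      & forall d : dart, uniq (face_walk s d)
          /\ (size (face_walk s d) = 5 \/ size (face_walk s d) = 6)].

Definition del_edges (C : {set {set G}}) : rel G :=
  [rel x y | adj x y && ([set x; y] \notin C)].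

Definition cyclic_5_edge_cut (C : {set {set G}}) : Prop :=
  [/\ C \subset edges, #|C| = 5, #|components (del_edges C)| = 2
    & {in components (del_edges C),
        forall A, contains_cycle (del_edges C) A}].

Definition trivial_cut (C : {set {set G}}) : Prop :=
  exists2 A, A \in components (del_edges C) & is_5_cycle (del_edges C) A.

Definition nontrivial_cyclic_5_edge_cut (C : {set {set G}}) : Prop :=
  cyclic_5_edge_cut C /\ ~ trivial_cut C.

End Graph.

(* Main.v *)
Require Import Defs.
From mathcomp Require Import all_boot all_order all_algebra.
From mathcomp Require Import reals exp.
From mathcomp Require Import perm zify lra.

(* Two facts about a fullerene suffice: it has no 4-cycle, and n >= 20.

   No 4-cycles: on each side of a 4-cycle exactly two of its vertices send
   their third edge to that side; if at most one did, the face on that side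
   would run along all four edges and so have length 4 or meet a vertex twice.
   The two faces on that side are then forced to be hexagons, and beyond them
   lies another 4-cycle.  Hence every face is a hexagon, which contradicts
   Euler's formula.

   Counting: for a proper vertex subset S, let m be the number of perfect
   matchings of the induced subgraph G[S] and e its number of edges; then
   m^6 <= 2^(2 e - |S|).  Indeed a matching edge vw removed together with its
   ends lowers 2 e - |S| by 2 (deg v + deg w - 2), and G[S] has a vertex of
   degree at most 2 to branch on since G is connected and cubic; branching at
   two adjacent vertices of degree 2 is where 4-cycles must be excluded.
   Branching once at a vertex of G gives m <= 3 * 2^((2 n - 8) / 6), which is
   at most 20^(n / 12) as soon as n >= 10. *)

Set Implicit Arguments.
Unset Strict Implicit.
Unset Printing Implicit Defensive.

Import Order.TTheory GRing.Theory Num.Theory.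

Definition four_cycle (G : sgraph) (a b c d : G) :=
  [/\ adj a b, adj b c, adj c d & [/\ adj d a, a != c & b != d]].

(** * Four-cycles in a cubic map with pentagonal and hexagonal faces *)

Section FourCycles.
Variables (G : sgraph) (turn : G -> G -> G).

(** The pair [(x, y)] stands for the dart from [x] to [y], and [turn ^~ y] for the rotation of the
    neighbours of [y]; faces are then the orbits of [advance]. *)
Definition advance (p : G * G) := (p.2, turn p.1 p.2).

Hypothesis turn_adj : forall x y, adj x y -> adj y (turn x y).
Hypothesis turn3 : forall x y, adj x y ->
  [/\ turn (turn (turn x y) y) y = x, turn x y != x,
      turn (turn x y) y != x & forall z, adj y z ->
      z \in [:: x; turn x y; turn (turn x y) y]].
Hypothesis face56 : forall p, adj p.1 p.2 -> exists2 k, (k == 5) || (k == 6) &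
  iter k advance p = p /\ uniq [seq (iter i advance p).1 | i <- iota 0 k].

(** Six consecutive vertices of the walk cover both face lengths; on a pentagon the sixth is the
    first again. *)
Lemma face_cases x0 x1 x2 x3 x4 x5 : adj x0 x1 ->
  turn x0 x1 = x2 -> turn x1 x2 = x3 -> turn x2 x3 = x4 -> turn x3 x4 = x5 ->
  [/\ x5 = x0, turn x4 x0 = x1 & uniq [:: x0; x1; x2; x3; x4]] \/
  [/\ turn x4 x5 = x0, turn x5 x0 = x1 & uniq [:: x0; x1; x2; x3; x4; x5]].
Proof.
move=> adj01 e2 e3 e4 e5; have [k /orP [] /eqP -> []] := @face56 (x0, x1) adj01.
  by rewrite /= /advance /= e2 e3 e4 e5 => -[E1 E2] U; left; split=> //; rewrite -E1.
by rewrite /= /advance /= e2 e3 e4 e5 => -[E1 E2] U; right; split=> //; rewrite -E1.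
Qed.

Lemma turn_third x y z : adj x y -> turn x y = z -> turn (turn z y) y = x.
Proof. by move=> /turn3 [e _ _ _] <-. Qed.

Lemma turn_neq2 x y z : adj x y -> turn x y = z -> turn z y <> x.
Proof. by move=> /turn3 [_ _ n _] <- e; rewrite e eqxx in n. Qed.

(** The third edge at [c] lies on one side of the path [p c n]. Either the face walk coming from [p]
    stays on the path, or that edge branches off on its side. *)
Lemma straight_or_branch p c n : adj p c -> adj c n -> p != n ->
  turn p c = n \/ turn n c = p.
Proof.
move=> pc cn pn; have [e _ _ /(_ n cn)] := turn3 pc.
rewrite !inE eq_sym (negbTE pn) /= => /orP [] /eqP; first by left.
by move=> nE; right; rewrite nE.
Qed.

Lemma branch_third p c n : adj c n -> turn n c = p -> turn (turn p c) c = n.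
Proof. by move=> cn; apply: turn_third; rewrite adj_sym. Qed.

Lemma four_cycle_rot (a b c d : G) : four_cycle a b c d -> four_cycle b c d a.
Proof. by move=> [? ? ? [? ? ?]]; split=> //; split=> //; rewrite eq_sym. Qed.

Lemma four_cycle_rev (a b c d : G) : four_cycle a b c d -> four_cycle a d c b.
Proof.
by move=> [? ? ? [? ? ?]]; split=> //; try split=> //; rewrite 1?adj_sym // eq_sym.
Qed.

(** * Faces along a four-cycle *)

Definition on_four_cycle (x y : G) := exists z w, four_cycle x y z w.

Definition face_meets_four_cycle p :=
  exists n, on_four_cycle (iter n advance p).1 (iter n advance p).2.

Lemma face_meets_four_cycle0 x y : on_four_cycle x y -> face_meets_four_cycle (x, y).
Proof. by exists 0. Qed.

Lemma face_meets_four_cycle1 x y :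
  on_four_cycle y (turn x y) -> face_meets_four_cycle (x, y).
Proof. by exists 1. Qed.

(** The walk is back at [a] after four steps, too early for a pentagon or a hexagon. *)
Lemma no_three_straight a b c d : four_cycle a b c d ->
  turn a b = c -> turn b c = d -> turn c d = a -> False.
Proof.
move=> [ab _ _ _] e1 e2 e3.
by have [] := face_cases ab e1 e2 e3 erefl => -[_ _]; rewrite /= !inE eqxx !orbT.
Qed.

(* The face walk starting with [(x0, x1)] is a hexagon, and the face across each
   of its edges contains an edge of a four-cycle. *)
Definition hexagon_among_four_cycles x0 x1 := exists x2 x3 x4 x5,
  [/\ turn x0 x1 = x2, turn x1 x2 = x3, turn x2 x3 = x4
    & [/\ turn x3 x4 = x5, turn x4 x5 = x0 & turn x5 x0 = x1]] /\
  [/\ face_meets_four_cycle (x1, x0), face_meets_four_cycle (x2, x1),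
      face_meets_four_cycle (x3, x2)
    & [/\ face_meets_four_cycle (x4, x3), face_meets_four_cycle (x5, x4)
        & face_meets_four_cycle (x0, x5)]].

Lemma hexagon_turn x y :
  hexagon_among_four_cycles x y -> hexagon_among_four_cycles y (turn x y).
Proof.
move=> [x2 [x3 [x4 [x5 [[e2 e3 e4 [e5 e6 e7]] [h1 h2 h3 [h4 h5 h6]]]]]]].
by exists x3, x4, x5, x; rewrite e2; split.
Qed.

(* The face that leaves [z] by its third edge would meet [z] twice. *)
Lemma no_inner_triangle a b z p q : adj a z -> adj z b -> adj a b ->
  turn b a = p -> turn p a = z -> turn z b = q -> turn q b = a ->
  turn a z = b -> False.
Proof.
move=> az zb ab ba_p pa_z zb_q qb_a az_b.
have za_b : turn z a = b.
  by rewrite -pa_z; apply: turn_third ba_p; rewrite adj_sym.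
have ab_z : turn a b = z by rewrite -qb_a; apply: turn_third zb_q.
have wz_a : turn (turn b z) z = a by apply: turn_third az_b.
have wz : adj (turn b z) z by rewrite adj_sym turn_adj // adj_sym.
by have [] := face_cases wz wz_a za_b ab_z erefl => -[_ _]; rewrite /= !inE eqxx !orbT ?andbF.
Qed.

(** The two faces run along [t0 c0 c1 c2 t2] and [t2 c2 c3 c0 t0]. Two pentagons would leave [t0]
    with only two neighbours, and exactly one pentagon gives an inner triangle. So both are
    hexagons, and their sixth vertices form a new four-cycle with [t0] and [t2]. *)
Lemma opposite_branches c0 c1 c2 c3 : four_cycle c0 c1 c2 c3 ->
  turn c1 c0 = c3 -> turn c3 c2 = c1 -> turn c0 c1 = c2 -> turn c2 c3 = c0 ->
  hexagon_among_four_cycles c0 c1.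
Proof.
move=> C b0 b2 e1 e3; have [c01 c12 c23 [c30 n02 n13]] := C.
pose t0 := turn c3 c0; pose t2 := turn c1 c2.
have t0c0 : turn t0 c0 = c1 := branch_third c01 b0.
have t2c2 : turn t2 c2 = c3 := branch_third c23 b2.
have c0t0 : adj c0 t0 := turn_adj c30.
have c2t2 : adj c2 t2 := turn_adj c12.
have adj_t0c0 : adj t0 c0 by rewrite adj_sym.
have adj_t2c2 : adj t2 c2 by rewrite adj_sym.
have t2x := turn_adj c2t2; have t0y := turn_adj c0t0.
have F1 := face_cases adj_t0c0 t0c0 e1 (erefl t2) erefl.
have F2 := face_cases adj_t2c2 t2c2 e3 (erefl t0) erefl.
case: F1 F2 => [[x1 x2 U1]|[x1 x2 U1]] [[y1 y2 U2]|[y1 y2 U2]].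
- by case: (turn_neq2 c0t0 y1 x2).
- case: (@no_inner_triangle t0 t2 (turn c0 t0) c0 c2) => //.
    by have := turn_adj t0y; rewrite y1 adj_sym.
  by rewrite -x1 adj_sym.
- case: (@no_inner_triangle t2 t0 (turn c2 t2) c2 c0) => //.
    by have := turn_adj t2x; rewrite x1 adj_sym.
  by rewrite -y1 adj_sym.
have xt0 := turn_adj t2x; have yt2 := turn_adj t0y; rewrite x1 y1 in xt0 yt2.
have C' : four_cycle t0 (turn c2 t2) t2 (turn c0 t0).
  split=> //; try split; rewrite 1?adj_sym //.
    by move: U1; rewrite /= !inE; case: (t0 == t2); rewrite ?orbT.
  by apply/eqP => xy; have := turn_neq2 xt0 x2; apply; rewrite -xy.
have D' := four_cycle_rev C'; have D := four_cycle_rev C.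
(* The hexagon is read from the dart [(t0, c0)], one step before [(c0, c1)]. *)
rewrite -t0c0; apply: hexagon_turn.
exists c1, c2, t2, (turn c2 t2); split; split=> //; try split=> //.
- by apply: face_meets_four_cycle1; do 2!eexists; exact: D'.
- apply: face_meets_four_cycle0; do 2!eexists.
  exact: four_cycle_rot (four_cycle_rot (four_cycle_rot D)).
- apply: face_meets_four_cycle0; do 2!eexists.
  exact: (four_cycle_rot (four_cycle_rot D)).
- apply: face_meets_four_cycle1; rewrite t2c2; do 2!eexists.
  exact: (four_cycle_rot (four_cycle_rot C)).
- apply: face_meets_four_cycle0; do 2!eexists.
  exact: four_cycle_rot C'.
- by apply: face_meets_four_cycle0; do 2!eexists; exact: C'.
Qed.

(** The face along [t1 c1 c2 c3 c0 t0] is no pentagon, as [t0 != t1]; so it is a hexagon with [t0]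
    and [t1] adjacent. The face along [t0 c0 c1 t1] is then a hexagon too, a pentagon giving an
    inner triangle, and its last two vertices form a new four-cycle with [t0] and [t1]. *)
Lemma adjacent_branches c0 c1 c2 c3 : four_cycle c0 c1 c2 c3 ->
  turn c1 c0 = c3 -> turn c2 c1 = c0 -> turn c1 c2 = c3 -> turn c2 c3 = c0 ->
  hexagon_among_four_cycles c0 c1 /\ hexagon_among_four_cycles c1 c2.
Proof.
move=> C b0 b1 e2 e3; have [c01 c12 c23 [c30 n02 n13]] := C.
pose t0 := turn c3 c0; pose t1 := turn c0 c1; pose z1 := turn c1 t1.
have t0c0 : turn t0 c0 = c1 := branch_third c01 b0.
have t1c1 : turn t1 c1 = c2 := branch_third c12 b1.
have c0t0 : adj c0 t0 := turn_adj c30.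
have c1t1 : adj c1 t1 := turn_adj c01.
have t1z1 : adj t1 z1 := turn_adj c1t1.
have adj_t0c0 : adj t0 c0 by rewrite adj_sym.
have adj_t1c1 : adj t1 c1 by rewrite adj_sym.
have F1 := face_cases adj_t0c0 t0c0 (erefl t1) (erefl z1) erefl.
have t01 : t0 != t1.
  by case: F1 => -[_ _]; rewrite /= !inE; case: (t0 == t1); rewrite ?orbT.
have [[t0E]|[x1 x2 _]] := face_cases adj_t1c1 t1c1 e2 e3 (erefl t0).
  by rewrite t0E eqxx in t01.
have adj_t01 : adj t0 t1 by rewrite -x1; exact: turn_adj.
case: F1 => [[y1 y2 U]|[y1 y2 U]].
  case: (@no_inner_triangle t1 t0 z1 c1 c0) => //; last by rewrite adj_sym.
  by have := turn_adj t1z1; rewrite y1.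
have z10 := turn_adj t1z1; have z0t0 := turn_adj z10; rewrite y1 in z0t0.
have C' : four_cycle t0 t1 z1 (turn t1 z1).
  split=> //; split=> //.
    by move: U; rewrite /= !inE; case: (t0 == z1); rewrite ?orbT.
  by move: U; rewrite /= !inE; case: (t1 == turn t1 z1); rewrite ?orbT ?andbF.
have D' := four_cycle_rev C'; have D := four_cycle_rev C.
have on r0 r1 r2 r3 : four_cycle r0 r1 r2 r3 -> on_four_cycle r0 r1 by exists r2, r3.
split.
  rewrite -t0c0; apply: hexagon_turn.
  exists c1, t1, z1, (turn t1 z1); split; split=> //; try split=> //.
  - by apply: face_meets_four_cycle1; rewrite x1; apply: on C'.
  - apply: face_meets_four_cycle0; apply: on.
    exact: four_cycle_rot (four_cycle_rot (four_cycle_rot D)).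
  - by apply: face_meets_four_cycle1; rewrite t1c1; apply: on (four_cycle_rot C).
  - apply: face_meets_four_cycle0; apply: on.
    exact: four_cycle_rot (four_cycle_rot D').
  - apply: face_meets_four_cycle0; apply: on; exact: four_cycle_rot D'.
  - by apply: face_meets_four_cycle0; apply: on D'.
rewrite -t1c1; apply: hexagon_turn.
exists c2, c3, c0, t0; split; split=> //; try split=> //.
- by apply: face_meets_four_cycle1; apply: on (four_cycle_rot C').
- apply: face_meets_four_cycle0; apply: on.
  exact: four_cycle_rot (four_cycle_rot D).
- by apply: face_meets_four_cycle0; apply: on (four_cycle_rot D).
- by apply: face_meets_four_cycle0; apply: on D.
- by apply: face_meets_four_cycle1; rewrite t0c0; apply: on C.
- apply: face_meets_four_cycle0; apply: on.
  exact: four_cycle_rot (four_cycle_rot (four_cycle_rot D')).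
Qed.

Lemma on_four_cycle_hexagon c0 c1 :
  on_four_cycle c0 c1 -> hexagon_among_four_cycles c0 c1.
Proof.
case=> c2 [c3 C0].
have C1 := four_cycle_rot C0; have C2 := four_cycle_rot C1; have C3 := four_cycle_rot C2.
have D0 := four_cycle_rev C0; have D1 := four_cycle_rot D0.
have D2 := four_cycle_rot D1; have D3 := four_cycle_rot D2.
have [c01 c12 c23 [c30 n02 n13]] := C0.
have n20 : c2 != c0 by rewrite eq_sym.
have n31 : c3 != c1 by rewrite eq_sym.
(* A branch on one side is straight on the other. Of the sixteen patterns, those with three straight
   corners on a side are refuted by [C0] to [C3] or [D0] to [D3]; the six with two branches per side
   remain. *)
case: (straight_or_branch c30 c01 n31) => e0;
case: (straight_or_branch c01 c12 n02) => e1;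
case: (straight_or_branch c12 c23 n13) => e2;
case: (straight_or_branch c23 c30 n20) => e3;
try by [case: (no_three_straight C0) | case: (no_three_straight C1)
  | case: (no_three_straight C2) | case: (no_three_straight C3)
  | case: (no_three_straight D0) | case: (no_three_straight D1)
  | case: (no_three_straight D2) | case: (no_three_straight D3)].
- have [_] := adjacent_branches C2 e2 e3 e0 e1.
  by move/hexagon_turn; rewrite e0.
- have := opposite_branches C3 e3 e1 e0 e2.
  by move/hexagon_turn; rewrite e0.
- have [_] := adjacent_branches C1 e1 e2 e3 e0.
  by move=> /hexagon_turn; rewrite e3 => /hexagon_turn; rewrite e0.
- by have [_] := adjacent_branches C3 e3 e0 e1 e2.
- exact: opposite_branches C0 e0 e2 e1 e3.
- by have [] := adjacent_branches C0 e0 e1 e2 e3.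
Qed.

(** * Spreading hexagons over the whole map *)

Lemma advance_adj p : adj p.1 p.2 -> adj (advance p).1 (advance p).2.
Proof. exact: turn_adj. Qed.

(** Face walks are periodic, so going on around the face leads back to [p]. *)
Lemma hexagon_advance_inv p : adj p.1 p.2 ->
  hexagon_among_four_cycles (advance p).1 (advance p).2 ->
  hexagon_among_four_cycles p.1 p.2.
Proof.
move=> adjp; have [k k56 [per _]] := face56 adjp.
have k0 : 0 < k by case/orP: k56 => /eqP->.
move=> h; rewrite -per -(prednK k0) iterSr.
by elim: k.-1 => //= n; apply: hexagon_turn.
Qed.

Lemma face_meets_hexagon p : adj p.1 p.2 ->
  face_meets_four_cycle p -> hexagon_among_four_cycles p.1 p.2.
Proof.
move=> adjp [n]; elim: n p adjp => [|n IHn] p adjp.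
  exact: on_four_cycle_hexagon.
rewrite iterSr => /(IHn _ (advance_adj adjp)); exact: hexagon_advance_inv.
Qed.

Lemma face_meets_rev x y : adj x y ->
  face_meets_four_cycle (x, y) -> face_meets_four_cycle (y, x).
Proof. by move=> xy /(@face_meets_hexagon (x, y) xy) [? [? [? [? [_ []]]]]]. Qed.

Lemma face_meets_turn x y : adj x y ->
  face_meets_four_cycle (x, y) -> face_meets_four_cycle (y, turn x y).
Proof.
move=> xy /(@face_meets_hexagon (x, y) xy) [? [? [? [? [[<- _ _ _] [_ h _ _]]]]]].
by apply: face_meets_rev => //; rewrite adj_sym turn_adj.
Qed.

(** Turning and reversing darts reaches all three neighbours of [y]. *)
Lemma face_meets_all x y z : adj x y -> adj y z ->
  face_meets_four_cycle (x, y) -> face_meets_four_cycle (y, z).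
Proof.
move=> xy yz h; have [_ _ _ /(_ z yz)] := turn3 xy; rewrite !inE.
have ty := turn_adj xy; have h1 := face_meets_turn xy h.
case/or3P => /eqP -> //; first exact: face_meets_rev.
by apply: face_meets_turn; [rewrite adj_sym | apply: face_meets_rev].
Qed.

(** Meeting a four-cycle spreads along a path from [b] to any vertex, and every face that meets one
    is a hexagon. *)
Lemma all_faces_hexagons (a b c d : G) : (forall x y, connect (@adj G) x y) ->
  four_cycle a b c d -> forall p, adj p.1 p.2 -> iter 6 advance p = p.
Proof.
move=> conn C [x y] /= xy.
have /connectP [q] := conn b x.
have abx z : adj b z -> face_meets_four_cycle (b, z).
  move=> bz; apply: (@face_meets_all a) => //; first by case: C => ? ? ? [].
  by apply: face_meets_four_cycle0; exists c, d.
have : forall z, adj x z -> x = last b q -> path (@adj G) b q -> face_meets_four_cycle (x, z).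
  elim: q b abx {C} => [|b' q IHq] b abx z xz /=.
    by move=> xE _; rewrite xE in xz *; exact: abx.
  move=> xE /andP [bb' bq]; apply: IHq xE bq => // z' b'z'.
  exact: face_meets_all (abx _ bb').
move=> h bq xE; have /(@face_meets_hexagon (x, y) xy) := h y xy xE bq.
move=> [x2 [x3 [x4 [x5 [[/= e2 e3 e4 [e5 e6 e7]] _]]]]].
by rewrite /advance /= e2 e3 e4 e5 e6 e7.
Qed.

End FourCycles.

(** * The rotation system of a fullerene *)

Section Embedding.
Variables (G : sgraph) (s : {perm dart G}).
Hypotheses (cub : cubic G) (rot : rotation_system s).

(* The third vertex on the face walk that starts with the dart [(x, y)]. *)
Definition turn (x y : G) : G :=
  if insub (y, x) is Some d then (val (s (d : dart G))).2 else x.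

Lemma turnE (d : dart G) : turn (val d).2 (val d).1 = (val (s d)).2.
Proof. by rewrite /turn -surjective_pairing valK. Qed.

Lemma rotation_src (d : dart G) : (val (s d)).1 = (val d).1.
Proof.
have : s d \in porbit s d by have := mem_porbit s 1 d; rewrite expg1.
by rewrite rot inE => /eqP.
Qed.

Lemma card_rotation_orbit (d : dart G) : #|porbit s d| = 3.
Proof.
rewrite rot -(cub (dart_src d)).
rewrite -(@card_in_imset _ _ (fun d' : dart G => (val d').2)).
  congr #|pred_of_set _|; apply/setP => w; rewrite inE; apply/imsetP/idP.
    by case=> d'; rewrite inE => /eqP <- ->; exact: (valP d').
  by move=> dw; exists (exist _ (dart_src d, w) dw : dart G); rewrite ?inE.
move=> d1 d2; rewrite !inE => /eqP e1 /eqP e2 e3; apply/val_inj.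
by rewrite [LHS]surjective_pairing [RHS]surjective_pairing e3 [(val d1).1]e1 [(val d2).1]e2.
Qed.

Lemma turn_adj x y : adj x y -> adj y (turn x y).
Proof.
rewrite adj_sym => yx; have := turnE (exist _ (y, x) yx) => /= ->.
have := rotation_src (exist _ (y, x) yx) => /= {1}<-; exact: (valP (s _)).
Qed.

Lemma turn3 x y : adj x y ->
  [/\ turn (turn (turn x y) y) y = x, turn x y != x,
      turn (turn x y) y != x & forall z, adj y z ->
      z \in [:: x; turn x y; turn (turn x y) y]].
Proof.
rewrite adj_sym => yx; pose d : dart G := exist _ (y, x) yx.
have dsE e : (val e).1 = y -> val (s e) = (y, turn (val e).2 y).
  by move=> eE; rewrite -{2}eE turnE -eE -rotation_src -surjective_pairing.
have d1 : val (s d) = (y, turn x y) by rewrite dsE.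
have d2 : val (s (s d)) = (y, turn (turn x y) y) by rewrite dsE d1.
have d3 : val (s (s (s d))) = (y, turn (turn (turn x y) y) y) by rewrite dsE d2.
have := iter_porbit s d; rewrite card_rotation_orbit /= => sd3.
have := uniq_traject_porbit s d; rewrite card_rotation_orbit /= !inE.
rewrite !negb_or => /andP [/andP [n1 n2] _].
split.
- by rewrite -[RHS]/(val d).2 -sd3 d3.
- by apply: contraNneq n1 => E; rewrite -val_eqE d1 E.
- by apply: contraNneq n2 => E; rewrite -val_eqE d2 E.
move=> z yz; have : (exist _ (y, z) yz : dart G) \in porbit s d by rewrite rot inE.
rewrite porbit_traject card_rotation_orbit !inE -!val_eqE d1 d2 /=.
by rewrite !xpair_eqE eqxx.
Qed.

Lemma advanceE (d : dart G) : val (face_step s d) = advance turn (val d).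
Proof.
rewrite /advance [LHS]surjective_pairing /face_step rotation_src.
by rewrite -turnE.
Qed.

Lemma iter_advanceE n (d : dart G) :
  val (iter n (face_step s) d) = iter n (advance turn) (val d).
Proof. by elim: n => //= n <-; rewrite advanceE. Qed.

Lemma face_step_inj : injective (face_step s).
Proof.
have revK : involutive (@dart_rev G) by move=> d; apply/val_inj; case: d => -[].
by move=> d1 d2 /perm_inj /(can_inj revK).
Qed.

Hypothesis face_sizes : forall d : dart G, uniq (face_walk s d) /\
  (size (face_walk s d) = 5 \/ size (face_walk s d) = 6).

Lemma order_face56 (d : dart G) :
  (order (face_step s) d == 5) || (order (face_step s) d == 6).
Proof.
by have [_] := face_sizes d; rewrite size_map size_orbit => -[] ->.
Qed.

Lemma face56 p : adj p.1 p.2 -> exists2 k, (k == 5) || (k == 6) &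
  iter k (advance turn) p = p /\
  uniq [seq (iter i (advance turn) p).1 | i <- iota 0 k].
Proof.
case: p => x y xy; pose d : dart G := exist _ (x, y) xy.
exists (order (face_step s) d); first exact: order_face56.
split; first by rewrite -[(x, y)]/(val d) -iter_advanceE iter_order //; exact: face_step_inj.
have [+ _] := face_sizes d; congr uniq; apply: (@eq_from_nth _ x).
  by rewrite !size_map size_orbit size_iota.
move=> i; rewrite size_map size_orbit => i_lt.
rewrite (nth_map d) ?size_orbit // (nth_map 0) ?size_iota // nth_iota // add0n.
by rewrite nth_traject // -[(x, y)]/(val d) -iter_advanceE.
Qed.

(** * Counting darts, edges and faces *)

Lemma card_dart : #|dart G| = 3 * #|G|.
Proof.
rewrite card_sig -sum1_card -(pair_big_dep xpredT (fun x y => adj x y) (fun _ _ => 1)) /=.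
under eq_bigr => x _.
  rewrite sum1_card (_ : #|_| = 3); last first.
    by rewrite -(cub x); apply: eq_card => w; rewrite !inE.
over.
by rewrite sum_nat_const mulnC.
Qed.

(** The fibre of the map from darts to edges is a pair of opposite darts. *)
Lemma card_edges : #|dart G| = 2 * #|edges G|.
Proof.
pose D := [set p : G * G | adj p.1 p.2]; pose h (p : G * G) := [set p.1; p.2].
have -> : #|dart G| = #|D| by rewrite card_sig cardsE.
have -> : edges G = h @: D.
  by apply/setP => e; apply/imsetP/imsetP => -[p pD ->]; exists p; rewrite // inE in pD *.
rewrite -sum1_card (partition_big_imset h) /= mulnC -sum_nat_const.
apply: eq_bigr => e /imsetP [[x y] + ->]; rewrite inE /= => xy.
have nxy : x != y by apply: contraTneq xy => ->; rewrite adj_irrefl.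
rewrite sum1_card (_ : 2 = #|[set (x, y); (y, x)]|); last first.
  by rewrite cards2 xpair_eqE (negbTE nxy).
apply: eq_card => -[a b]; rewrite !inE /= !xpair_eqE.
rewrite unfold_in /= inE /h /=; apply/andP/orP => [[ab /eqP /setP E]|].
  have nab : a != b by apply: contraTneq ab => ->; rewrite adj_irrefl.
  have := E b; have := E a; rewrite !inE !eqxx orbT /=.
  move=> /esym /orP [] /eqP aE /esym /orP [] /eqP bE.
  - by rewrite aE bE eqxx in nab.
  - by left; rewrite aE bE !eqxx.
  - by right; rewrite aE bE !eqxx.
  - by rewrite aE bE eqxx in nab.
by case=> /andP [/eqP -> /eqP ->]; rewrite ?xy ?eqxx // adj_sym xy setUC.
Qed.

Hypothesis euler : #|G| + fcard (face_step s) predT = #|edges G| + 2.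

(** If all [f] faces were hexagons, [6 f = 3 n = 2 e] would give [n + f = e], against Euler's
    formula. *)
Lemma not_all_hexagons :
  ~ (forall p : G * G, adj p.1 p.2 -> iter 6 (advance turn) p = p).
Proof.
move=> hex.
have h6 : @predT (dart G) \subset order_set (face_step s) 6.
  apply/subsetP => d _; have := order_face56 d; rewrite inE orbC => /orP [//|/eqP d5].
  (* On a pentagon the sixth step is the first, so [d] would be fixed by [face_step s] and be a
     loop. *)
  have := iter_order face_step_inj d; rewrite d5 => it5.
  have := hex (val d) (valP d); rewrite -iter_advanceE iterS it5 => /(congr1 fst).
  rewrite advanceE /= => yx; have := valP d; by rewrite /= yx adj_irrefl.
have := fcard_order_set face_step_inj h6 (fun _ _ _ => erefl).
rewrite (_ : #|predT| = #|dart G|); last exact: eq_card.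
move: card_dart card_edges euler; clear.
by move: (fcard _ _) => f; lia.
Qed.

(** From [5 f5 + 6 f6 = 3 n = 2 e] and Euler's formula, [f5 = 12]; the pentagons alone carry 60 of
    the [3 n] darts. *)
Lemma card_fullerene_ge20 : 20 <= #|G|.
Proof.
pose a : pred (dart G) := order_set (face_step s) 5.
have order1 d : order (face_step s) (face_step s d) = order (face_step s) d.
  apply: eq_card => d'; rewrite !inE.
  by rewrite (same_fconnect1 face_step_inj d).
have cl k : fclosed (face_step s) (order_set (face_step s) k).
  by move=> d _ /eqP <-; rewrite !inE order1.
have cl' : fclosed (face_step s) [predC a] by move=> d _ /eqP <-; rewrite !inE order1.
have := n_compC a (frel (face_step s)).
have h5 := fcard_order_set face_step_inj (subxx a) (cl 5).
have sub : [predC a] \subset order_set (face_step s) 6.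
  by apply/subsetP => d; rewrite !inE; have := order_face56 d; case: eqP.
have h6 := fcard_order_set face_step_inj sub cl'.
have := cardC a.
rewrite (_ : fcard _ (dart G) = fcard (face_step s) predT) //.
move: card_dart card_edges euler h5 h6; rewrite -/a; clear.
by move: (fcard _ _) (fcard _ _) (fcard _ _) #|a| #|[predC a]| => f f5 f6 n5 n6; lia.
Qed.

End Embedding.

(** * Perfect matchings of induced subgraphs *)

Section Matchings.
Variable G : sgraph.
Implicit Types (S : {set G}) (M : {set {set G}}) (v w x y : G).

Definition nbrs S v : {set G} := [set w in S | adj v w].

(** A perfect matching of the induced subgraph is encoded as a partition of [S] into edges, so that
    removing a matched pair removes a block. *)
Definition matchings_on S : {set {set {set G}}} :=
  [set M | partition M S && (M \subset edges G)].

(** This is [2 e], for [e] the number of edges induced on [S]. *)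
Definition degsum S := \sum_(x in S) #|nbrs S x|.

Lemma edgeP e :
  reflect (exists x y, adj x y /\ e = [set x; y]) (e \in edges G).
Proof.
apply: (iffP imsetP) => [[[x y] xy ->]|[x [y [xy ->]]]].
  by exists x, y; rewrite inE in xy.
by exists (x, y); rewrite ?inE.
Qed.

Lemma adj_neq x y : adj x y -> x != y.
Proof. by apply: contraTneq => ->; rewrite adj_irrefl. Qed.

Lemma perfect_matchingsE : perfect_matchings G = matchings_on setT.
Proof.
apply/setP => M; rewrite !inE [LHS]andbC; case E: (M \subset _) => /=; last by rewrite !andbF.
rewrite !andbT.
apply/forallP/and3P => [H|[/eqP cM tM _] v].
  split.
  - rewrite eqEsubset subsetT; apply/subsetP => v _; apply/bigcupP.
    have /cards1P [a aE] := H v.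
    have: a \in [set a in M | v \in a] by rewrite aE inE.
    by rewrite inE => /andP [aM va]; exists a.
  - apply/trivIsetP => A B AM BM; apply: contraR => /pred0Pn [x /andP [/= xA xB]].
    have /cards1P [a aE] := H x.
    have: A \in [set a in M | x \in a] by rewrite inE AM.
    have: B \in [set a in M | x \in a] by rewrite inE BM.
    by rewrite aE !inE => /eqP-> /eqP->.
  - apply/negP => /(subsetP E) /edgeP [x [y [_ /setP /(_ x)]]].
    by rewrite !inE eqxx.
apply/cards1P; exists (pblock M v); apply/setP => a; rewrite !inE.
apply/andP/eqP => [[aM va]|->]; first by rewrite (def_pblock tM aM va).
by rewrite pblock_mem ?mem_pblock cM ?inE.
Qed.

(** Sort the matchings by the partner [w] of [v]; removing the block [vw] is injective. *)
Lemma matchings_branch S v : v \in S ->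
  #|matchings_on S| <= \sum_(w in nbrs S v) #|matchings_on (S :\ v :\ w)|.
Proof.
move=> vS.
have step w : w \in nbrs S v ->
    #|[set M in matchings_on S | [set v; w] \in M]|
      <= #|matchings_on (S :\ v :\ w)|.
  rewrite inE => /andP [wS vw].
  rewrite -(@card_in_imset _ _ (fun M => M :\ [set v; w])).
    apply/subset_leq_card/subsetP => _ /imsetP [M + ->].
    rewrite !inE -andbA => /and3P [pM ME eM].
    have -> : S :\ v :\ w = S :\: [set v; w].
      by apply/setP => x; rewrite !inE negb_or; case: (x == v); case: (x == w).
    rewrite partitionD1 //=; apply: subset_trans ME; exact: subD1set.
  move=> M N; rewrite !inE => /andP [_ eM] /andP [_ eN] MN.
  by rewrite -(setD1K eM) -(setD1K eN) MN.
apply: (leq_trans _ (leq_sum _ step)).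
rewrite -sum1_card.
under [leqRHS]eq_bigr => w _ do rewrite -sum1_card.
(* After the exchange, each matching only has to be counted once, at the partner of [v]. *)
rewrite (exchange_big_dep (mem (matchings_on S))) /=; last first.
  by move=> w M _; rewrite inE => /andP [].
apply: leq_sum => M MS; have := MS; rewrite inE => /andP [pM ME].
have [cM tM _] := and3P pM.
have vM : v \in cover M by rewrite (eqP cM).
have vb : v \in pblock M v by rewrite mem_pblock.
have := subsetP ME _ (pblock_mem vM) => /edgeP [x [y [xy bE]]].
have [w [vw bE']] : exists w, adj v w /\ pblock M v = [set v; w].
  move: vb; rewrite bE !inE => /orP [] /eqP ->; first by exists y.
  by exists x; rewrite adj_sym setUC.
have wS : w \in nbrs S v.
  rewrite inE vw andbT -(eqP cM); apply/bigcupP; exists (pblock M v).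
    exact: pblock_mem.
  by rewrite bE' !inE eqxx orbT.
rewrite (bigD1 w) /= ?add1n //.
by rewrite wS inE MS -bE' pblock_mem.
Qed.

Lemma nbrsD1 S v x : nbrs (S :\ v) x = nbrs S x :\ v.
Proof. by apply/setP => y; rewrite !inE andbA. Qed.

Lemma degD1_adj S v x : v \in S -> adj x v ->
  #|nbrs S x| = #|nbrs (S :\ v) x|.+1.
Proof. by move=> vS xv; rewrite nbrsD1 (cardsD1 v) inE vS xv. Qed.

Lemma degD1_nadj S v x : ~~ adj x v -> #|nbrs (S :\ v) x| = #|nbrs S x|.
Proof. by move=> xv; rewrite nbrsD1 [RHS](cardsD1 v) inE (negbTE xv) andbF. Qed.

Lemma degsumD1 S v : v \in S -> degsum S = degsum (S :\ v) + (#|nbrs S v|).*2.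
Proof.
move=> vS; rewrite /degsum (big_setD1 v) //=.
have -> : \sum_(x in S :\ v) #|nbrs S x| =
  \sum_(x in S :\ v) #|nbrs (S :\ v) x| + \sum_(x in S :\ v) adj x v.
  rewrite -big_split; apply: eq_bigr => x _ /=.
  by rewrite [in LHS](cardsD1 v) nbrsD1 inE vS addnC.
have -> : \sum_(x in S :\ v) adj x v = #|nbrs S v|.
  rewrite -sum1_card big_mkcond [RHS]big_mkcond; apply: eq_bigr => x _.
  rewrite !inE (adj_sym x); case: eqP => [->|_]; first by rewrite adj_irrefl andbF.
  by case: (x \in S); case: (adj v x).
by rewrite addnC -addnA addnn.
Qed.

Lemma matchings_on0 : #|matchings_on set0| <= 1.
Proof.
rewrite -(cards1 (set0 : {set {set G}})); apply/subset_leq_card/subsetP => M.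
by rewrite !inE partition_set0 => /andP [].
Qed.

(** The bound [m^6 <= 2^(2 e - |S|)], multiplied out to avoid truncated subtraction. *)
Definition matching_bound S := #|matchings_on S| ^ 6 * 2 ^ #|S| <= 2 ^ degsum S.

(** Here [2 e - |S|] drops by at least [c] in passing from [S] to [S']. *)
Lemma matching_bound_drop S S' c : matching_bound S' ->
  degsum S' + #|S| + c <= degsum S + #|S'| ->
  #|matchings_on S'| ^ 6 * 2 ^ c * 2 ^ #|S| <= 2 ^ degsum S.
Proof.
move=> b le; rewrite -(@leq_pmul2r (2 ^ #|S'|)) ?expn_gt0 // -[leqRHS]expnD.
apply: leq_trans (leq_pexp2l (isT : 0 < 2) le); rewrite !expnD.
have := b; rewrite /matching_bound.
move: (_ ^ 6) (2 ^ #|S'|) (2 ^ c) (2 ^ #|S|) (2 ^ degsum S') => A B C D K AB.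
have -> : A * C * D * B = A * B * (D * C) by nia.
by rewrite -[leqRHS]mulnA leq_mul2r AB orbT.
Qed.

Lemma matchings_forced S v w : v \in S -> nbrs S v = [set w] ->
  #|matchings_on S| <= #|matchings_on (S :\ v :\ w)|.
Proof. by move=> vS vE; have := matchings_branch vS; rewrite vE big_set1. Qed.

Lemma matchings_isolated S v : v \in S -> nbrs S v = set0 -> #|matchings_on S| = 0.
Proof.
by move=> vS vE; have := matchings_branch vS; rewrite vE big_set0 leqn0 => /eqP.
Qed.

Lemma matchings_branch2 S v w x : v \in S -> w != x -> nbrs S v = [set w; x] ->
  #|matchings_on S|
    <= #|matchings_on (S :\ v :\ w)| + #|matchings_on (S :\ v :\ x)|.
Proof.
move=> vS wx vE; have := matchings_branch vS.
by rewrite vE big_setU1 ?inE //= big_set1.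
Qed.

Lemma degsumD2 S v w : v \in S -> w \in S -> adj v w ->
  (degsum S).+2 = degsum (S :\ v :\ w) + (#|nbrs S v|).*2 + (#|nbrs S w|).*2.
Proof.
move=> vS wS vw; rewrite (degsumD1 vS) (@degsumD1 _ w); last first.
  by rewrite !inE wS andbT eq_sym adj_neq.
rewrite (@degD1_adj S v w) // 1?adj_sym //; lia.
Qed.

Lemma cardsD2 S v w : v \in S -> w \in S -> v != w -> #|S| = #|S :\ v :\ w|.+2.
Proof.
move=> vS wS vw; rewrite (cardsD1 v) vS (cardsD1 w (S :\ v)) !inE wS.
by rewrite eq_sym vw.
Qed.

Lemma card2_other (A : {set G}) x : x \in A -> #|A| = 2 ->
  exists2 y, x != y & A = [set x; y].
Proof.
move=> xA; rewrite (cardsD1 x) xA => -[] /eqP /cards1P [y yE].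
exists y; last by rewrite -(setD1K xA) yE.
have : y \in A :\ x by rewrite yE inE.
by rewrite !inE eq_sym => /andP [].
Qed.

(** A drop of 6 halves the bound, so two such branches are affordable. *)
Lemma expn6_sum_leq a b K : a ^ 6 * 2 ^ 6 <= K -> b ^ 6 * 2 ^ 6 <= K ->
  (a + b) ^ 6 <= K.
Proof.
wlog ab : a b / a <= b => [hw aK bK|_ bK].
  by have [ab|/ltnW ba] := leqP a b; [apply: hw | rewrite addnC; apply: hw].
apply: leq_trans bK; rewrite -expnMn leq_exp2r //; lia.
Qed.

(* [3/2 < 2 ^ (2/3)], i.e. [2 ^ (-4/6) + 2 ^ (-10/6) < 1] *)
Lemma expn6_sum_leq_4_10 a b K : a ^ 6 * 2 ^ 4 <= K -> b ^ 6 * 2 ^ 10 <= K ->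
  (a + b) ^ 6 <= K.
Proof.
move=> aK bK; pose m := maxn a (2 * b).
have mK : m ^ 6 * 2 ^ 4 <= K.
  rewrite /m; case: (leqP a) => _ //; rewrite expnMn mulnAC -expnD mulnC.
  exact: bK.
apply: leq_trans mK; rewrite -(@leq_pmul2l (2 ^ 6)) // -expnMn.
have -> : 2 ^ 6 * (m ^ 6 * 2 ^ 4) = (4 ^ 5) * m ^ 6 by rewrite mulnCA mulnC.
apply: (@leq_trans ((3 * m) ^ 6)); first by rewrite leq_exp2r //; rewrite /m; lia.
by rewrite expnMn leq_mul2r orbC.
Qed.

Lemma matching_bound_add S S1 S2 c1 c2 :
  (forall a b K, a ^ 6 * 2 ^ c1 <= K -> b ^ 6 * 2 ^ c2 <= K -> (a + b) ^ 6 <= K) ->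
  #|matchings_on S| <= #|matchings_on S1| + #|matchings_on S2| ->
  matching_bound S1 -> matching_bound S2 ->
  degsum S1 + #|S| + c1 <= degsum S + #|S1| ->
  degsum S2 + #|S| + c2 <= degsum S + #|S2| ->
  matching_bound S.
Proof.
move=> sum le b1 b2 /(matching_bound_drop b1) d1 /(matching_bound_drop b2) d2.
(* The quotient by [2 ^ #|S|] serves as [K]; rounding it down is harmless, the left side being an
   integer. *)
rewrite /matching_bound -leq_divRL ?expn_gt0 //.
apply: (@leq_trans ((#|matchings_on S1| + #|matchings_on S2|) ^ 6)).
  by rewrite leq_exp2r.
by apply: sum; rewrite leq_divRL ?expn_gt0.
Qed.

Lemma matching_bound_le S S' : #|matchings_on S| <= #|matchings_on S'| ->
  matching_bound S' -> degsum S' + #|S| <= degsum S + #|S'| -> matching_bound S.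
Proof.
move=> le b d.
have := @matching_bound_drop S S' 0 b; rewrite addn0 muln1 => /(_ d).
by apply: leq_trans; rewrite leq_mul2r leq_exp2r // le orbT.
Qed.

(** * The induction step for the matching bound *)

Section NoFourCycle.
Hypothesis no_four_cycle : forall a b c d : G, ~ four_cycle a b c d.
Variable S : {set G}.
Hypothesis IH : forall T : {set G}, T \proper S -> matching_bound T.

Lemma matching_bound_D2 v w : v \in S -> matching_bound (S :\ v :\ w).
Proof.
move=> vS; apply: IH; apply: sub_proper_trans (properD1 vS).
exact: subD1set.
Qed.

Lemma matching_bound_D4 v w x y : v \in S -> matching_bound (S :\ v :\ w :\ x :\ y).
Proof.
move=> vS; apply: IH; apply: sub_proper_trans (properD1 vS).
exact: subset_trans (subD1set _ _) (subset_trans (subD1set _ _) (subD1set _ _)).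
Qed.

(** The edge [vw] is forced, and the drop [2 (deg w - 1)] is not negative. *)
Lemma matching_bound_deg1 v w : v \in S -> nbrs S v = [set w] -> matching_bound S.
Proof.
move=> vS vE; have : w \in nbrs S v by rewrite vE inE.
rewrite inE => /andP [wS vw].
apply: (matching_bound_le (matchings_forced vS vE) (matching_bound_D2 w vS)).
have := degsumD2 vS wS vw; rewrite (cardsD2 vS wS (adj_neq vw)) vE cards1.
have : 0 < #|nbrs S w| by apply/card_gt0P; exists v; rewrite inE vS adj_sym.
lia.
Qed.

(** Both branches drop by [2 (2 + 3 - 2) = 6]. *)
Lemma matching_bound_deg33 v w x : v \in S -> w != x -> nbrs S v = [set w; x] ->
  #|nbrs S w| = 3 -> #|nbrs S x| = 3 -> matching_bound S.
Proof.
move=> vS wx vE w3 x3.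
have : w \in nbrs S v by rewrite vE !inE eqxx.
have : x \in nbrs S v by rewrite vE !inE eqxx orbT.
rewrite !inE => /andP [xS vx] /andP [wS vw].
apply: (matching_bound_add expn6_sum_leq (matchings_branch2 vS wx vE));
  try exact: matching_bound_D2.
  have := degsumD2 vS wS vw; rewrite (cardsD2 vS wS (adj_neq vw)) w3 vE cards2 wx.
  lia.
have := degsumD2 vS xS vx; rewrite (cardsD2 vS xS (adj_neq vx)) x3 vE cards2 wx.
lia.
Qed.

(** * Branching on a path [x v w u] with [v] and [w] of degree 2 *)

Section Path.
Variables u w v x : G.
Hypotheses (vS : v \in S) (wx : w != x) (vu : v != u) (ux : u != x).
Hypotheses (vE : nbrs S v = [set w; x]) (wE : nbrs S w = [set v; u]).

Let wvS : (w \in S) && adj v w.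
Proof. by have := set21 w x; rewrite -vE inE. Qed.
Let xvS : (x \in S) && adj v x.
Proof. by have := set22 w x; rewrite -vE inE. Qed.
Let uwS : (u \in S) && adj w u.
Proof. by have := set22 v u; rewrite -wE inE. Qed.
Let wu : w != u.
Proof. by case/andP: uwS => _ /adj_neq. Qed.
Let nuv : ~~ adj u v.
Proof.
apply/negP => uv; have : u \in nbrs S v by rewrite inE adj_sym uv; case/andP: uwS => ->.
by rewrite vE !inE (negbTE ux) eq_sym (negbTE wu).
Qed.
Let nxw : ~~ adj x w.
Proof.
apply/negP => xw; have : x \in nbrs S w by rewrite inE adj_sym xw; case/andP: xvS => ->.
rewrite wE !inE [x == u]eq_sym (negbTE ux) orbF => /eqP xv.
by case/andP: xvS; rewrite xv adj_irrefl.
Qed.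
(** An edge [ux] would close a four-cycle and take 2 off the drop of the second branch. *)
Let nux : ~~ adj u x.
Proof.
case/andP: uwS wvS xvS => _ wu' /andP [_ vw] /andP [_ vx]; apply/negP => ux'.
by case: (@no_four_cycle v w u x); split=> //; split=> //; rewrite adj_sym.
Qed.

Let T1 := S :\ v :\ w.
Let T2 := S :\ v :\ x :\ w :\ u.

(** Once [v] is matched to [x], only [u] is left for [w]. *)
Lemma path_branch :
  #|matchings_on S| <= #|matchings_on T1| + #|matchings_on T2|.
Proof.
apply: leq_trans (matchings_branch2 vS wx vE) _; rewrite leq_add2l.
apply: matchings_forced.
  by rewrite !inE wx eq_sym; case/andP: wvS => -> /adj_neq ->.
rewrite !nbrsD1 wE; apply/setP => y; rewrite !inE.
case: (y =P x) => [->|_] /=; first by rewrite eq_sym (negbTE ux).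
by case: (y =P v) => [->|_] //=; rewrite (negbTE vu).
Qed.

Lemma path_degsum1 : degsum S = degsum T1 + 6 /\ #|S| = #|T1| + 2.
Proof.
case/andP: wvS => wS vw; have := degsumD2 vS wS vw.
rewrite (cardsD2 vS wS (adj_neq vw)) vE wE !cards2 wx vu /T1; clear; lia.
Qed.

(** The path is induced, so [deg x + deg u + 1] edges disappear and the drop is
    [2 (deg x + deg u) - 2]. *)
Lemma path_degsum2 :
  degsum S = degsum T2 + (#|nbrs S x| + #|nbrs S u|).*2 + 2 /\ #|S| = #|T2| + 4.
Proof.
case/andP: wvS => wS vw; case/andP: xvS => xS vx; case/andP: uwS => uS wu'.
have wT : w \in S :\ v :\ x by rewrite !inE wx wS andbT eq_sym adj_neq.
have uT : u \in S :\ v :\ x by rewrite !inE ux uS andbT eq_sym.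
have := degsumD2 vS xS vx; have := degsumD2 wT uT wu'.
rewrite (cardsD2 vS xS (adj_neq vx)) (cardsD2 wT uT wu) -/T2.
have -> : #|nbrs (S :\ v :\ x) u| = #|nbrs S u| by rewrite !degD1_nadj.
have -> : #|nbrs (S :\ v :\ x) w| = 1.
  rewrite degD1_nadj; last by rewrite adj_sym.
  by apply: succn_inj; rewrite -degD1_adj // 1?adj_sym // wE cards2 vu.
rewrite vE cards2 wx; clear; lia.
Qed.

Hypothesis deg_ge2 : forall y, y \in S -> 1 < #|nbrs S y|.

(** The drops are 4 for [T1] and [2 (3 + 3) - 2 = 10] for [T2]. *)
Lemma matching_bound_path33 : #|nbrs S u| = 3 -> #|nbrs S x| = 3 -> matching_bound S.
Proof.
move=> u3 x3; apply: (matching_bound_add expn6_sum_leq_4_10 path_branch).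
- exact: matching_bound_D2.
- exact: matching_bound_D4.
- by have := path_degsum1; clear; lia.
- by have := path_degsum2; rewrite u3 x3; clear; lia.
Qed.

(** In [T1] the vertex [u] keeps a single neighbour [u'], so [uu'] is forced and the first drop
    grows to [4 + 2 (deg u' - 1) >= 6]; the second is [2 (deg x + 2) - 2 >= 6]. *)
Lemma matching_bound_path2 : #|nbrs S u| = 2 -> matching_bound S.
Proof.
move=> u2; case/andP: uwS => uS wu'; case/andP: wvS => wS vw.
case/andP: xvS => xS vx.
have [|u' wu'' uE] := @card2_other (nbrs S u) w _ u2.
  by rewrite inE wS adj_sym.
have : u' \in nbrs S u by rewrite uE set22.
rewrite inE => /andP [u'S uu'].
have u'v : u' != v by apply: contraNneq nuv => <-.
have u'x : u' != x by apply: contraNneq nux => <-.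
have nu'v : ~~ adj u' v.
  apply/negP => h; have : u' \in nbrs S v by rewrite inE u'S adj_sym.
  by rewrite vE !inE (negbTE u'x) eq_sym (negbTE wu'').
have nu'w : ~~ adj u' w.
  apply/negP => h; have : u' \in nbrs S w by rewrite inE u'S adj_sym.
  by rewrite wE !inE (negbTE u'v) eq_sym (negbTE (adj_neq uu')).
have uT : u \in T1 by rewrite !inE uS andbT eq_sym wu eq_sym vu.
have u'T : u' \in T1 by rewrite !inE u'S u'v eq_sym wu''.
apply: (matching_bound_add (S1 := T1 :\ u :\ u') (S2 := T2) expn6_sum_leq).
- apply: leq_trans path_branch _; rewrite leq_add2r; apply: matchings_forced => //.
  rewrite !nbrsD1 uE; apply/setP => y; rewrite !inE.
  case: (y =P w) => [->|_] /=; first by rewrite (negbTE wu'').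
  by case: (y =P u') => [->|_]; rewrite ?u'v ?andbF.
- exact: matching_bound_D4.
- exact: matching_bound_D4.
- have := degsumD2 uT u'T uu'; have := path_degsum1.
  rewrite (cardsD2 uT u'T (adj_neq uu')).
  have -> : #|nbrs T1 u'| = #|nbrs S u'| by rewrite !degD1_nadj.
  have -> : #|nbrs T1 u| = 1.
    apply: succn_inj; rewrite -degD1_adj ?degD1_nadj //; last by rewrite adj_sym.
    by rewrite !inE wS andbT eq_sym adj_neq.
  by have := deg_ge2 u'S; clear; lia.
- by have := path_degsum2; have := deg_ge2 xS; rewrite u2; clear; lia.
Qed.

End Path.

Lemma matching_bound_step v : (forall y, y \in S -> 1 < #|nbrs S y| <= 3) ->
  v \in S -> #|nbrs S v| = 2 -> matching_bound S.
Proof.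
move=> deg vS v2.
have deg_ge2 y : y \in S -> 1 < #|nbrs S y| by move/deg/andP => [].
have [w] : exists w, w \in nbrs S v by apply/card_gt0P; rewrite v2.
move=> wv; have [x wx vE] := card2_other wv v2.
have : x \in nbrs S v by rewrite vE set22.
move: wv; rewrite !inE => /andP [wS vw] /andP [xS vx].
wlog w2 : w x wS vw xS vx wx vE / #|nbrs S w| = 2.
  move=> hw; have /andP [w_ge w_le] := deg _ wS; have /andP [x_ge x_le] := deg _ xS.
  have [w2|w2] := eqVneq #|nbrs S w| 2; first exact: (hw w x).
  have [x2|x2] := eqVneq #|nbrs S x| 2.
    by apply: (hw x w) => //; rewrite 1?eq_sym // setUC.
  by apply: (matching_bound_deg33 vS wx vE); lia.
have [|u vu wE] := @card2_other (nbrs S w) v _ w2; first by rewrite inE vS adj_sym.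
(* If [v w x] is a triangle, matching [v] to [x] isolates [w], so only the branch [vw] counts. *)
have [ux|ux] := eqVneq u x.
  have wT : w \in S :\ v :\ x by rewrite !inE wx wS andbT eq_sym adj_neq.
  have w0 : nbrs (S :\ v :\ x) w = set0.
    rewrite !nbrsD1 wE ux; apply/setP => y; rewrite !inE.
    by case: (y =P x); case: (y =P v).
  apply: (matching_bound_le (S' := S :\ v :\ w)).
  - apply: leq_trans (matchings_branch2 vS wx vE) _.
    by rewrite (matchings_isolated wT w0) addn0.
  - exact: matching_bound_D2.
  - have := degsumD2 vS wS vw.
    by rewrite v2 w2 (cardsD2 vS wS (adj_neq vw)); lia.
have : u \in nbrs S w by rewrite wE set22.
rewrite inE => /andP [uS wu].
have /andP [u_ge u_le] := deg _ uS; have /andP [x_ge x_le] := deg _ xS.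
have [u2|u2] := eqVneq #|nbrs S u| 2; first exact: (matching_bound_path2 vS wx vu ux).
have [x2|x2] := eqVneq #|nbrs S x| 2.
  (* The same path read backwards. *)
  by apply: (@matching_bound_path2 x v w u) => //; rewrite 1?eq_sym // setUC.
by apply: (matching_bound_path33 vS wx vu ux) => //; lia.
Qed.

End NoFourCycle.

Lemma connected_connect : connected G -> forall x y, connect (@adj G) x y.
Proof.
have sym : connect_sym (@adj G) by apply: sym_connect_sym; exact: adj_sym.
have equiv : {in [set: G] & &, equivalence_rel (connect (@adj G))}.
  by move=> x y z _ _ _; split=> // xy; rewrite (same_connect sym xy).
move=> /eqP /cards1P [A AE] x y.
have cE : cover (components (@adj G)) = [set: G].
  exact: cover_partition (equivalence_partitionP equiv).
have inA z : pblock (components (@adj G)) z = A.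
  by apply/set1P; rewrite -AE pblock_mem // cE inE.
rewrite -(pblock_equivalence_partition equiv) ?inE // -/(components _) inA -(inA y).
by rewrite mem_pblock cE inE.
Qed.

(** * From proper induced subgraphs to the whole graph *)

Section ConnectedCubic.
Hypotheses (conn : connected G) (cub : cubic G).
Hypothesis no_four_cycle : forall a b c d : G, ~ four_cycle a b c d.

Lemma nbrsT v : #|nbrs setT v| = 3.
Proof. by rewrite -(cub v); apply: eq_card => w; rewrite !inE. Qed.

Lemma nbrs_leq3 S v : #|nbrs S v| <= 3.
Proof.
by rewrite -(nbrsT v); apply/subset_leq_card/subsetP => w; rewrite !inE => /andP [].
Qed.

(** Otherwise [S] would be closed under adjacency, hence everything by connectedness. *)
Lemma exists_deg_lt3 S : S != set0 -> S != setT ->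
  exists2 v, v \in S & #|nbrs S v| < 3.
Proof.
move=> /set0Pn [x xS] ST; apply/exists_inP; apply: contraNT ST.
rewrite negb_exists_in => /forall_inP full; apply/eqP/setP => y; rewrite inE.
suff cl : closed (@adj G) (mem S).
  by have := closed_connect cl (connected_connect conn x y); rewrite -!topredE /= => <-.
apply: intro_closed; first by apply: sym_connect_sym; exact: adj_sym.
move=> v w vw /= vS.
have /eqP E : nbrs S v == nbrs setT v.
  rewrite eqEcard nbrsT leqNgt full // andbT.
  by apply/subsetP => z; rewrite !inE => /andP [].
have : w \in nbrs setT v by rewrite !inE.
by rewrite -E inE => /andP [].
Qed.

Lemma matching_bound_proper S : S != setT -> matching_bound S.
Proof.
have [n] := ubnP #|S|; elim: n S => // n IHn S Sn ST.
have IH (T : {set G}) : T \proper S -> matching_bound T.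
  move=> TS; apply: IHn; first exact: leq_trans (proper_card TS) Sn.
  by apply: contraTneq TS => ->; rewrite properE subsetT andbF.
have [->|S0] := eqVneq S set0.
  rewrite /matching_bound cards0 /degsum big_set0 muln1 expn0.
  by rewrite -(exp1n 6) leq_exp2r // matchings_on0.
have [/exists_inP [v vS]|] := boolP [exists v in S, #|nbrs S v| <= 1].
  rewrite leq_eqVlt ltnS leqn0 => /orP [/cards1P [w vE]|/eqP /cards0_eq v0].
    exact: (matching_bound_deg1 IH vS vE).
  by rewrite /matching_bound (matchings_isolated vS v0) exp0n // mul0n.
rewrite negb_exists_in => /forall_inP deg.
have [v vS v_lt3] := exists_deg_lt3 S0 ST.
apply: (matching_bound_step no_four_cycle IH _ vS).
  by move=> y yS; rewrite ltnNge deg // nbrs_leq3.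
by have := deg v vS; move: v_lt3; clear; lia.
Qed.

(** Removing two adjacent vertices from the whole graph leaves [2 e - |S| = (3 n - 10) - (n - 2) = 2
    n - 8], for each of the three partners of [v]. *)
Lemma perfect_matchings_bound :
  #|perfect_matchings G| ^ 6 * 2 ^ 8 <= 3 ^ 6 * 4 ^ #|G|.
Proof.
have /eqP /cards1P [A AE] := conn.
have /imsetP [v _ _] : A \in components (@adj G) by rewrite AE set11.
rewrite perfect_matchingsE.
pose m := \max_(w in nbrs setT v) #|matchings_on (setT :\ v :\ w)|.
have le : #|matchings_on setT| <= 3 * m.
  apply: leq_trans (matchings_branch (in_setT v)) _.
  by rewrite -(nbrsT v) -sum_nat_const; apply: leq_sum => w wv; exact: leq_bigmax_cond.
suff mb : m ^ 6 * 2 ^ 8 <= 4 ^ #|G|.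
  apply: (@leq_trans ((3 * m) ^ 6 * 2 ^ 8)); first by rewrite leq_mul2r leq_exp2r // le orbT.
  by rewrite expnMn -mulnA leq_mul2l mb orbT.
have [w] : exists w, w \in nbrs setT v by apply/card_gt0P; rewrite nbrsT.
move=> wv; have nv : 0 < #|nbrs setT v| by rewrite nbrsT.
have [x xv mE] := @eq_bigmax_cond _ (mem (nbrs setT v))
  (fun w => #|matchings_on (setT :\ v :\ w)|) nv.
rewrite /m mE.
have vx : adj v x by move: xv; rewrite /= !inE.
have b : matching_bound (setT :\ v :\ x).
  apply: matching_bound_proper; apply/eqP => /setP /(_ x); by rewrite !inE eqxx.
have d := degsumD2 (in_setT v) (in_setT x) vx.
have c := cardsD2 (in_setT v) (in_setT x) (adj_neq vx).
rewrite cardsT !nbrsT in d c.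
have dT : degsum setT = 3 * #|G|.
  rewrite /degsum; under eq_bigr do rewrite nbrsT.
  by rewrite sum_nat_const cardsT mulnC.
rewrite -[4]/(2 ^ 2) -expnM -(@leq_pmul2r (2 ^ #|G|)) ?expn_gt0 //.
rewrite -[leqRHS]expnD.
have -> : 2 * #|G| + #|G| = degsum setT by rewrite dT; clear; lia.
rewrite -cardsT; apply: matching_bound_drop => //.
by rewrite cardsT; move: d c dT; clear; lia.
Qed.

End ConnectedCubic.

End Matchings.

(** * Numerical comparison and conclusion *)

Local Open Scope ring_scope.

(** Squaring the hypothesis and writing [20 = 16 * (5/4)] leaves [(729/256)^2 <= (5/4)^n], which
    holds from [n = 10] on. *)
Lemma expr12_leq_20 (R : realType) (N n : nat) : (10 <= n)%N ->
  (N ^ 6 * 2 ^ 8 <= 3 ^ 6 * 4 ^ n)%N -> (N%:R : R) ^+ 12 <= 20%:R ^+ n.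
Proof.
move=> n10; rewrite -(ler_nat R) (natrM _ (N ^ 6)) (natrM _ (3 ^ 6)) !natrX => h.
have y_ge : (5 / 4 : R) ^+ 10 <= (5 / 4) ^+ n by apply: ler_weXn2l => //; lra.
have -> : 20%:R ^+ n = (4%:R ^+ n) ^+ 2 * (5 / 4 : R) ^+ n.
  by rewrite exprAC -exprMn; congr (_ ^+ n); lra.
rewrite (exprM _ 6 2).
have u0 : 0 <= (N%:R : R) ^+ 6 by apply: exprn_ge0.
have v0 : 0 <= (4%:R : R) ^+ n by apply: exprn_ge0.
move: (N%:R ^+ 6) (4%:R ^+ n) ((5 / 4) ^+ n) => u v y in u0 v0 h y_ge *.
have uv : u <= 729 / 256 * v by lra.
have y9 : (729 / 256) ^+ 2 <= y by apply: le_trans y_ge; lra.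
apply: (@le_trans _ _ ((729 / 256 * v) ^+ 2)).
  by rewrite ler_pXn2r ?nnegrE //; lra.
by rewrite exprMn mulrC ler_wpM2l ?exprn_ge0.
Qed.

Theorem mainTheorem11 (R : realType) (G : sgraph)
    (hG : fullerene G)
    (hC : exists C : {set {set G}}, nontrivial_cyclic_5_edge_cut C) :
  (#|perfect_matchings G|%:R : R) <= (20%:R : R) `^ (#|G|%:R / 12%:R).
Proof.
case: hG => conn cub [s [rot euler] sizes].
have no4 (a b c d : G) : ~ four_cycle a b c d.
  move=> C.
  apply: (not_all_hexagons cub rot sizes euler).
  apply: (@all_faces_hexagons _ _ _ _ _ a b c d) => //.
  - exact: turn_adj.
  - exact: turn3.
  - exact: face56.
  - exact: connected_connect.
have n20 := card_fullerene_ge20 cub sizes euler.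
have bound := perfect_matchings_bound conn cub no4.
(* Twelfth powers turn the real exponent into a natural one. *)
rewrite -(@ler_pXn2r _ 12) ?nnegrE ?powR_ge0 //.
rewrite -[leRHS]powR_mulrn ?powR_ge0 // -powRrM divfK ?pnatr_eq0 //.
rewrite powR_mulrn //; apply: expr12_leq_20 bound; exact: leq_trans n20.
Qed.
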